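(* Fix $n\ge1$. For any $\varepsilon>0$, the convex program $$\text{(D)}\qquad \sup_{w,\lambda,s_j,z_j}\ \frac1n\Bigl(-\lambda\varepsilon+\frac1N\sum_{j=1}^N s_j\Bigr)$$ subject to $$\min_{x\in\mathfrak X}\Bigl[\log\bigl(c(w)+w^\top x\bigr)+z_j^\top(x-\widehat{\mathcal X}_j)\Bigr]\ge s_j,\quad j=1,\dots,N,$$ $$\lambda\ge0,\qquad \|z_j\|_*\le\lambda,\quad j=1,\dots,N,\qquad w\in\overline{\mathcal W}_{\rm s},$$ is equivalent to the following convex program with concave objective function: $$\text{(D')}\qquad \sup_{w,\lambda,s_j,z_j}\ \frac1n\Bigl(-\lambda\varepsilon+\frac1N\sum_{j=1}^N s_j\Bigr)$$ subject to $$\min_{x^v\in{\rm Ext}(\mathfrak X)}\Bigl[\log\bigl(c(w)+w^\top x^v\bigr)+z_j^\top(x^v-\widehat{\mathcal X}_j)\Bigr]\ge s_j,\quad j=1,\dots,N,$$ $$\lambda\ge0,\qquad \|z_j\|_*\le\lambda,\quad j=1,\dots,N,\qquad w\in\overline{\mathcal W}_{\rm s},$$ where $z_j\in\mathbb R^m$, $\|z_j\|_*$ is the dual norm of $z_j$, and ${\rm Ext}(\mathfrak X)$ is the set of extreme points of $\mathfrak X$.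
   Context: Setting. $m$ is the number of assets in the portfolio, $n\ge 1$ is the (integer) number of steps between rebalancings, and $V(0)>0$ is the initial account value. $\mathcal W:=\{w\in\mathbb R^m: \mathbf 1^\top w=1,\ w_i\ge 0\ \text{for all } i\}$. Returns. The support set of the random vector of $n$-period compound returns of the $m$ assets is the box $\mathfrak X:=\{x\in\mathbb R^m:\mathcal X_{\min,i}\le x_i\le\mathcal X_{\max,i},\ i=1,\dots,m\}$, where $\mathcal X_{\min,i}:=(1+X_{\min,i})^n-1>-1$ and $\mathcal X_{\max,i}:=(1+X_{\max,i})^n-1<\infty$, with $X_{\min,i}$ and $X_{\max,i}$ the lower and upper bounds on the per-period return of asset $i$. $\widehat{\mathcal X}_1,\dots,\widehat{\mathcal X}_N$ are $N$ samples of the compound return vector. Transaction costs. For each $i$, $TC_i$ is a continuous convex function giving the transaction cost for asset $i$ as a function of the amount traded. With amounts $u_i=w_iV(0)$, the total cost $\sum_{i=1}^m TC_i(w_iV(0))$ lies in $[0,V(0))$. Define $c(w):=1-\frac{1}{V(0)}\sum_{i=1}^m TC_i(w_iV(0))$, a concave function of $w$. Feasible weights. $\mathcal W_{\rm s}:=\mathcal W\cap\{w\in\mathbb R^m:\ \sum_{i=1}^m w_i\mathcal X_{\min,i}+c(w)>0\}$ and $\overline{\mathcal W}_{\rm s}$ is its closure. $\|\cdot\|$ is a norm on $\mathbb R^m$ with dual norm $\|z\|_*:=\max_x\{z^\top x:\|x\|\le1\}$. The number $\varepsilon$ is the radius of a Wasserstein ball of distributions on $\mathfrak X$ around the empirical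 distribution of the samples; (D) arises as a convex approximation of the problem of maximizing over $w$ the worst-case value of $\frac1n\mathbb E[\log(c(w)+w^\top\mathcal X)]$ over that ball, where $\mathcal X$ is the compound return vector. *)

(* Defs.v *)
From HB Require Import structures.
From mathcomp Require Import all_boot all_order all_algebra.
From mathcomp Require Import all_classical all_reals all_analysis.

Set Implicit Arguments.
Unset Strict Implicit.
Unset Printing Implicit Defensive.

Import Order.TTheory GRing.Theory Num.Theory.
Import numFieldNormedType.Exports.

Local Open Scope classical_set_scope.
Local Open Scope ring_scope.

Section Vectors.
Variables (R : realType) (m : nat).
Implicit Types (A : set 'rV[R]_m) (u v x y z : 'rV[R]_m).

Definition dot u v : R := \sum_(i < m) u 0 i * v 0 i.

(* Nonnegativity of [nrm] follows from these three properties. *)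
Definition is_norm (nrm : 'rV[R]_m -> R) : Prop :=
  [/\ forall x y, nrm (x + y) <= nrm x + nrm y,
      forall (a : R) x, nrm (a *: x) = `|a| * nrm x
    & forall x, nrm x = 0 -> x = 0].

(* The supremum is taken in the extended reals so that it is meaningful before
   the unit ball of [nrm] is known to be bounded. *)
Definition dual_norm (nrm : 'rV[R]_m -> R) z : \bar R :=
  ereal_sup [set (dot z x)%:E | x in [set x | nrm x <= 1]].

Definition extreme_points A : set 'rV[R]_m :=
  [set x | A x /\
     forall y z (t : R), A y -> A z -> 0 < t -> t < 1 ->
       x = t *: y + (1 - t) *: z -> y = x /\ z = x].

Definition box (lo hi : 'rV[R]_m) : set 'rV[R]_m :=
  [set x | forall i, lo 0 i <= x 0 i <= hi 0 i].

End Vectors.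

Definition attains_min (R : realType) (T : Type) (A : set T) (f : T -> \bar R) :=
  exists2 x, A x & forall y, A y -> (f x <= f y)%E.

Section Programs.
Variables (R : realType) (V : lmodType R).

Record max_program := MaxProgram {
  objective : V -> R;
  feasible : set V }.

Definition optimal_value (P : max_program) : \bar R :=
  ereal_sup [set (objective P v)%:E | v in feasible P].

Definition optimal_solutions (P : max_program) : set V :=
  [set v | feasible P v /\
     forall u, feasible P u -> objective P u <= objective P v].

(* A maximization problem: the concavity of the objective is the convexity of
   its opposite. *)
Definition convex_program (P : max_program) : Prop :=
  convex_set (feasible P) /\
  convex_function (feasible P) (fun v => - objective P v).

Definition equivalent_programs (P Q : max_program) : Prop :=
  [/\ feasible P = feasible Q,
      forall v, feasible P v -> objective P v = objective Q v,
      optimal_value P = optimal_value Q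
    & optimal_solutions P = optimal_solutions Q].

End Programs.

Section Portfolio.
Variables (R : realType) (m : nat).
Implicit Types (w x z : 'rV[R]_m).

Definition simplex : set 'rV[R]_m :=
  [set w : 'rV[R]_m | \sum_(i < m) w 0 i = 1 /\ forall i, 0 <= w 0 i].

Definition compound (n : nat) (X : 'rV[R]_m) : 'rV[R]_m :=
  \row_(i < m) ((1 + X 0 i) ^+ n - 1).

Definition total_cost (V0 : R) (TC : 'I_m -> R -> R) w : R :=
  \sum_(i < m) TC i (w 0 i * V0).

Definition net_wealth (V0 : R) (TC : 'I_m -> R -> R) w : R :=
  1 - V0^-1 * total_cost V0 TC w.

Definition safe_weights (V0 : R) (TC : 'I_m -> R -> R) (lo : 'rV[R]_m) :
    set 'rV[R]_m :=
  simplex `&` [set w : 'rV[R]_m | 0 < \sum_(i < m) w 0 i * lo 0 i + net_wealth V0 TC w].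

(* On the boundary of the closure of the safe weights the argument of the
   logarithm may vanish; [lne] gives [lne 0 = -oo] (while [ln 0 = 0]). *)
Definition log_term (V0 : R) (TC : 'I_m -> R -> R) w z (xhat x : 'rV[R]_m) :
    \bar R :=
  (lne (net_wealth V0 TC w + dot w x)%:E + (dot z (x - xhat))%:E)%E.

(* Decision variables (w, lambda, s, z): s_j is [s 0 j], z_j is [row j z]. *)
Definition decision (N : nat) : lmodType R :=
  ('rV[R]_m * R^o * 'rV[R]_N * 'M[R]_(N, m))%type.

Definition dro_objective (N n : nat) (eps : R) (d : decision N) : R :=
  let: (w, lambda, s, z) := d in
  n%:R^-1 * (- lambda * eps + N%:R^-1 * \sum_(j < N) s 0 j).

Definition dro_feasible (N : nat) (V0 : R) (TC : 'I_m -> R -> R)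
    (lo : 'rV[R]_m) (xhat : 'I_N -> 'rV[R]_m) (nrm : 'rV[R]_m -> R)
    (A : set 'rV[R]_m) : set (decision N) :=
  [set d : decision N | let: (w, lambda, s, z) := d in
    [/\ forall j, ((s 0 j)%:E <=
          ereal_inf [set log_term V0 TC w (row j z) (xhat j) x | x in A])%E,
        0 <= lambda,
        forall j, (dual_norm nrm (row j z) <= lambda%:E)%E
      & closure (safe_weights V0 TC lo) w]].

(* The set [A] over which the inner minimum is taken is the only difference
   between the two programs: the whole support, or its extreme points. *)
Definition dro_program (N n : nat) (V0 eps : R) (TC : 'I_m -> R -> R)
    (lo : 'rV[R]_m) (xhat : 'I_N -> 'rV[R]_m) (nrm : 'rV[R]_m -> R)
    (A : set 'rV[R]_m) : max_program (decision N) :=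
  MaxProgram (@dro_objective N n eps) (dro_feasible V0 TC lo xhat nrm A).

End Portfolio.

(* Main.v *)
(* For fixed w and z, the superlevel sets of x |-> log (c(w) + w.x) + z.(x - xhat)
   are convex.  A convex set containing the vertices of a box contains the box, so
   the best vertex minimizes over the whole box; since vertices are extreme points,
   the two inner minima agree, and so do the feasible sets of (D) and (D').
   A point satisfying a constraint s <= log (...) + ... has a positive argument of
   the logarithm, because the logarithm of a nonpositive number is -oo; concavity
   of the logarithm can therefore be used on the positive reals only, and the
   boundary of the safe weights needs no separate treatment. *)
Require Import Defs.
From HB Require Import structures.
From mathcomp Require Import all_boot all_order all_algebra.
From mathcomp Require Import all_classical all_reals all_analysis.
From mathcomp Require Import ring lra.

Set Implicit Arguments.
Unset Strict Implicit.
Unset Printing Implicit Defensive.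

Import Order.TTheory GRing.Theory Num.Theory.
Import numFieldNormedType.Exports.

Local Open Scope classical_set_scope.
Local Open Scope ring_scope.

(** * Convex combinations and closures *)

Lemma convE (R : numDomainType) (E : lmodType R) (t : {i01 R})
    (x y : convex_lmodType E) :
  conv t x y = t%:num *: (x : E) + (1 - t%:num) *: (y : E) :> E.
Proof. by []. Qed.

Lemma conv_weight_bounds (R : numDomainType) (t : {i01 R}) :
  0 <= t%:num :> R /\ t%:num <= 1 :> R.
Proof. by split; [exact: ge0 | exact: le1]. Qed.

(** Points of the closure are limits of proper filters containing [A]. Along the product of two such
    filters the convex combinations stay in [A] and converge to the combination of the limits. *)
Lemma convex_closure (R : numFieldType) (E : normedModType R) (A : set E) :
  convex_set (A : set (convex_lmodType E)) ->
  convex_set (closure A : set (convex_lmodType E)).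
Proof.
move=> cA x y t /set_mem; rewrite [X in X x]closureEcvg => -[F FF [Fx AF]].
move=> /set_mem; rewrite [X in X y]closureEcvg => -[G FG [Gy AG]].
apply/mem_set.
have FG' : ProperFilter (filter_prod F G) := filter_prod_proper.
have c1 : (@fst E E) @ filter_prod F G --> (x : E).
  by move=> B nB; exact: cvg_fst (Fx _ nB).
have c2 : (@snd E E) @ filter_prod F G --> (y : E).
  by move=> B nB; exact: cvg_snd (Gy _ nB).
have /(_ _ _ _) cvg := cvgD (cvgZl_tmp (k := t%:num) c1) (cvgZl_tmp (k := 1 - t%:num) c2).
refine (closed_cvg (closure A) (@closed_closure _ A) _ _ cvg).
exists (A, A); first by split; [exact: AF | exact: AG].
move=> [a b] [/= Aa Ab]; apply: subset_closure.
by apply: set_mem; apply: cA; exact: mem_set.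
Qed.

(** * Vertices of a box *)

Section BoxVertices.
Variables (R : realType) (m : nat) (lo hi : 'rV[R]_m).

Definition vertex (b : {ffun 'I_m -> bool}) : 'rV[R]_m :=
  \row_i (if b i then hi 0 i else lo 0 i).

Definition set_coord (x : 'rV[R]_m) (i : 'I_m) (a : R) : 'rV[R]_m :=
  \row_k (if k == i then a else x 0 k).

Hypothesis lo_hi : forall i, lo 0 i <= hi 0 i.

Lemma vertex_box b : box lo hi (vertex b).
Proof. by move=> i; rewrite mxE; case: (b i); rewrite lexx lo_hi. Qed.

(** Induction on a list [s] of free coordinates, those allowed to lie strictly between their bounds.
    Freeing coordinate [i] puts [x] on the segment joining the two points obtained by pushing that
    coordinate to its bounds. *)
Lemma convex_vertices_box (S : set 'rV[R]_m) :
  convex_set (S : set (convex_lmodType 'rV[R]_m)) ->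
  (forall b, S (vertex b)) -> box lo hi `<=` S.
Proof.
move=> cS vS.
suff H (s : seq 'I_m) : forall x, box lo hi x ->
    (forall i, i \notin s -> x 0 i = lo 0 i \/ x 0 i = hi 0 i) -> S x.
  by move=> x bx; apply: (H (enum 'I_m)) => // i; rewrite mem_enum.
elim: s => [|i s IH] x bx xs.
  rewrite (_ : x = vertex [ffun k => x 0 k == hi 0 k]); first exact: vS.
  apply/rowP => k; rewrite mxE ffunE; case: eqP => // ne.
  by case: (xs k).
have end_in a : a = lo 0 i \/ a = hi 0 i -> S (set_coord x i a).
  move=> aE; apply: IH => [k|k ks]; rewrite mxE; case: eqP => [->|ki].
  - by case: aE => ->; rewrite lexx lo_hi.
  - exact: bx.
  - by [].
  - by apply: xs; rewrite inE negb_or ks andbT; apply/eqP.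
have /andP[lox xhi] := bx i.
(* A degenerate side is treated apart, since the weight [t] below divides by the side length. *)
have [lohi|ne] := eqVneq (lo 0 i) (hi 0 i).
  suff <- : set_coord x i (lo 0 i) = x by apply: end_in; left.
  apply/rowP => k; rewrite mxE; case: eqP => [->|//].
  by apply/eqP; rewrite eq_le lox lohi xhi.
have d0 : 0 < hi 0 i - lo 0 i by rewrite subr_gt0 lt_neqAle ne lo_hi.
(* The solution of [x 0 i = t * lo 0 i + (1 - t) * hi 0 i]. *)
pose t := (hi 0 i - x 0 i) / (hi 0 i - lo 0 i).
have t0 : 0 <= t by rewrite divr_ge0 ?subr_ge0.
have t1 : t <= 1 by rewrite ler_pdivrMr// mul1r; lra.
have /set_mem := cS _ _ (Itv01 t0 t1) (mem_set (end_in _ (or_introl erefl)))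
  (mem_set (end_in _ (or_intror erefl))).
rewrite convE/=; congr S; apply/rowP => k; rewrite !mxE.
case: eqP => [->|_]; last by ring.
by rewrite /t; field; rewrite gt_eqF.
Qed.

(** Coordinatewise, an endpoint of an interval is a strict convex combination of two points of that
    interval only if both equal the endpoint. *)
Lemma vertex_extreme b : extreme_points (box lo hi) (vertex b).
Proof.
split=> [|y z t by_ bz t0 t1 /rowP vE]; first exact: vertex_box.
suff yz k : y 0 k = vertex b 0 k /\ z 0 k = vertex b 0 k.
  by split; apply/rowP => k; case: (yz k).
move: (vE k) (by_ k) (bz k); rewrite !mxE.
have s0 : 0 < 1 - t by rewrite subr_gt0.
by case: (b k) => e /andP[? ?] /andP[? ?]; split; nra.
Qed.

End BoxVertices.

(** * The simplex and the concavity of the logarithmic term *)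

Lemma closed_simplex (R : realType) (m : nat) : closed (@simplex R m).
Proof.
have sum_cont : continuous (fun w : 'rV[R]_m => \sum_(i < m) w 0 i).
  by apply: continuous_big => [|i _]; [exact: add_continuous | exact: coord_continuous].
rewrite (_ : @simplex R m =
    (fun w : 'rV[R]_m => \sum_(i < m) w 0 i) @^-1` [set a | a = 1] `&`
    \bigcap_i ((fun w : 'rV[R]_m => w 0 i) @^-1` [set a | 0 <= a])).
  apply: closedI.
    by apply: ((continuous_closedP _).1 sum_cont); exact: closed_eq.
  apply: closed_bigI => i _.
  apply: ((continuous_closedP _).1 (@coord_continuous _ _ _ 0 i)).
  exact: closed_ge.
by apply/seteqP; split=> w [w1 w0]; split=> // i *; exact: w0.
Qed.

Lemma dotZDl (R : realType) (m : nat) (a b : R) (u v x : 'rV[R]_m) :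
  dot (a *: u + b *: v) x = a * dot u x + b * dot v x.
Proof.
rewrite /dot !mulr_sumr -big_split/=; apply: eq_bigr => i _.
by rewrite !mxE; ring.
Qed.

Lemma dotC (R : realType) (m : nat) (u v : 'rV[R]_m) : dot u v = dot v u.
Proof. by apply: eq_bigr => i _; rewrite mulrC. Qed.

(** The real lower bounds [r] and [s] force [a] and [b] to be positive, so concavity of [ln]
    applies. The slack between [c] and the combination of [a] and [b] accommodates a net wealth that
    is only concave in the weights. *)
Lemma le_lneD_conv (R : realType) (t : {i01 R}) (a b c p q r s : R) :
  (r%:E <= lne a%:E + p%:E)%E -> (s%:E <= lne b%:E + q%:E)%E ->
  t%:num * a + (1 - t%:num) * b <= c ->
  ((t%:num * r + (1 - t%:num) * s)%:E <=
     lne c%:E + (t%:num * p + (1 - t%:num) * q)%:E)%E.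
Proof.
have [a0|a0] := leP a 0; first by rewrite le0_lneNy ?lee_fin.
have [b0|b0] := leP b 0; first by rewrite (@le0_lneNy _ b%:E) ?lee_fin.
have ab0 : 0 < t%:num * a + (1 - t%:num) * b := convR_gt0 t a0 b0.
rewrite (lne_EFin a0) (lne_EFin b0) -!EFinD !lee_fin => ra sb abc.
have c0 := lt_le_trans ab0 abc.
rewrite lne_EFin// -EFinD lee_fin.
have : t%:num * ln a + (1 - t%:num) * ln b <= ln c.
  by apply: le_trans (concave_ln t a0 b0) _; rewrite ler_ln ?posrE.
have [t0 t1] := conv_weight_bounds t; nra.
Qed.

Lemma convex_log_term_superlevel (R : realType) (m : nat) (V0 : R)
    (TC : 'I_m -> R -> R) (w z xhat : 'rV[R]_m) (r : R) :
  convex_set ([set x | (r%:E <= log_term V0 TC w z xhat x)%E]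
    : set (convex_lmodType 'rV[R]_m)).
Proof.
move=> x y t /set_mem/= rx /set_mem/= ry; apply/mem_set => /=.
have cwE : net_wealth V0 TC w + dot w (conv t x y) =
    t%:num * (net_wealth V0 TC w + dot w x) +
    (1 - t%:num) * (net_wealth V0 TC w + dot w y).
  by rewrite convE dotC dotZDl !(dotC _ w); ring.
have zE : dot z (conv t x y - xhat) =
    t%:num * dot z (x - xhat) + (1 - t%:num) * dot z (y - xhat).
  rewrite (_ : _ - xhat = t%:num *: (x - xhat) + (1 - t%:num) *: (y - xhat)).
    by rewrite dotC dotZDl !(dotC _ z).
  by rewrite convE; apply/rowP => i; rewrite !mxE; ring.
rewrite /log_term cwE zE.
(* The level [r] is its own convex combination; there is no slack because the argument of the
   logarithm is affine in [x]. *)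
by apply: le_trans (le_lneD_conv rx ry (lexx _)); rewrite lee_fin; lra.
Qed.

Lemma convex_simplex (R : realType) (m : nat) :
  convex_set (@simplex R m : set (convex_lmodType 'rV[R]_m)).
Proof.
move=> x y t /set_mem[x1 x0] /set_mem[y1 y0]; apply/mem_set; rewrite convE.
have [t0 t1] := conv_weight_bounds t.
split=> [|i]; last by rewrite !mxE addr_ge0 ?mulr_ge0 ?subr_ge0.
under eq_bigr do rewrite !mxE.
by rewrite big_split/= -!mulr_sumr x1 y1; ring.
Qed.

(** * Concavity of net wealth and convexity of the safe weights *)

Section NetWealth.
Variables (R : realType) (m : nat) (V0 : R) (TC : 'I_m -> R -> R).
Hypothesis V0_gt0 : 0 < V0.
Hypothesis TC_convex :
  forall i, convex_function (`[0, V0] : set R^o) (TC i).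

(** Places the traded amounts in the interval on which the costs are convex. *)
Lemma simplex_amount (w : 'rV[R]_m) i : simplex w -> w 0 i * V0 \in (`[0, V0]%classic : set R).
Proof.
move=> [w1 w0]; apply/mem_set; rewrite /= in_itv/=.
rewrite mulr_ge0 ?(ltW V0_gt0)//= ger_pMl//.
by rewrite -w1 (bigD1 i)//= lerDl sumr_ge0.
Qed.

Lemma net_wealth_concave (t : {i01 R}) (u v : 'rV[R]_m) :
  simplex u -> simplex v ->
  t%:num * net_wealth V0 TC u + (1 - t%:num) * net_wealth V0 TC v <=
  net_wealth V0 TC (t%:num *: u + (1 - t%:num) *: v).
Proof.
move=> su sv; have : total_cost V0 TC (t%:num *: u + (1 - t%:num) *: v) <=
    t%:num * total_cost V0 TC u + (1 - t%:num) * total_cost V0 TC v.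
  rewrite /total_cost !mulr_sumr -big_split/=; apply: ler_sum => i _.
  rewrite !mxE mulrDl -!mulrA.
  exact: (TC_convex i t (simplex_amount i su) (simplex_amount i sv)).
rewrite -(ler_pM2l (x := V0^-1)) ?invr_gt0// /net_wealth; lra.
Qed.

Lemma convex_safe_weights (lo : 'rV[R]_m) :
  convex_set (safe_weights V0 TC lo : set (convex_lmodType 'rV[R]_m)).
Proof.
move=> u v t /set_mem[su lu] /set_mem[sv lv]; apply/mem_set; split.
  by apply: set_mem; apply: convex_simplex; exact: mem_set.
have := convR_gt0 t lu lv; rewrite convRE convE/= => /lt_le_trans; apply.
have := net_wealth_concave t su sv.
have := dotZDl t%:num (1 - t%:num) u v lo.
by rewrite /dot /unstable.onem => -> ?; lra.
Qed.

(** Makes concavity of net wealth available for weights on the boundary of the safe set as well. *)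
Lemma closure_safe_weights_simplex (lo : 'rV[R]_m) :
  closure (safe_weights V0 TC lo) `<=` @simplex R m.
Proof.
rewrite [X in _ `<=` X](_ : _ = closure (@simplex R m)).
  by apply: closure_subset => w [].
by apply/closure_id; exact: closed_simplex.
Qed.

End NetWealth.

(** * Minimization over a box and over its extreme points *)

Section BoxMinimum.
Variables (R : realType) (m : nat) (lo hi : 'rV[R]_m).
Hypothesis lo_hi : forall i, lo 0 i <= hi 0 i.
Variable f : 'rV[R]_m -> \bar R.
Hypothesis f_lty : forall x, (f x < +oo)%E.
Hypothesis f_superlevel : forall r : R,
  convex_set ([set x | (r%:E <= f x)%E] : set (convex_lmodType 'rV[R]_m)).

Lemma box_min_at_extreme_point :
  exists2 v, extreme_points (box lo hi) v &
    forall x, box lo hi x -> (f v <= f x)%E.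
Proof.
(* There are finitely many vertices, so a best one exists; the constant function only shows that
   there is at least one. *)
have [b0 _ minb] := @arg_minP _ _ _ [ffun=> true] predT
  (fun b => f (vertex lo hi b)) isT.
exists (vertex lo hi b0); first exact: vertex_extreme.
(* If the best value is a real [r], the superlevel set at [r] is convex and contains every vertex,
   hence the box. If it is [-oo], it is trivially minimal. *)
case fb: (f (vertex lo hi b0)) (f_lty (vertex lo hi b0)) minb => [r| |] //.
- move=> _ minb; apply: (convex_vertices_box lo_hi (@f_superlevel r)) => b.
  exact: minb.
- by move=> _ _ x _; rewrite leNye.
Qed.

Lemma box_attains_min : attains_min (box lo hi) f.
Proof. by have [v [bv _] vmin] := box_min_at_extreme_point; exists v. Qed.

Lemma extreme_points_attains_min : attains_min (extreme_points (box lo hi)) f.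
Proof.
by have [v ev vmin] := box_min_at_extreme_point; exists v => // y [/vmin].
Qed.

Lemma ereal_inf_extreme_points :
  ereal_inf [set f x | x in extreme_points (box lo hi)] =
  ereal_inf [set f x | x in box lo hi].
Proof.
have [v ev vmin] := box_min_at_extreme_point.
apply/eqP; rewrite eq_le; apply/andP; split; apply: le_ereal_inf_tmp.
  move=> _ [x /vmin fvx <-]; apply: le_trans fvx.
  by apply: ereal_inf_lbound; exists v.
by move=> _ [x [bx _] <-]; apply: ereal_inf_lbound; exists x.
Qed.

End BoxMinimum.

Lemma log_term_lty (R : realType) (m : nat) (V0 : R) (TC : 'I_m -> R -> R)
    (w z xhat x : 'rV[R]_m) :
  (log_term V0 TC w z xhat x < +oo)%E.
Proof. by rewrite /log_term /=; case: ifP => _ //; rewrite -EFinD ltry. Qed.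

(** Replaces the extended supremum by inequalities that are linear in [z] and [l], from which
    convexity of the constraint can be read off. *)
Lemma dual_norm_leP (R : realType) (m : nat) (nrm : 'rV[R]_m -> R)
    (z : 'rV[R]_m) (l : R) :
  (dual_norm nrm z <= l%:E)%E <-> forall x, nrm x <= 1 -> dot z x <= l.
Proof.
split=> [zl x x1|H].
  by rewrite -lee_fin; apply: le_trans zl; apply: ereal_sup_ubound; exists x.
by apply: ge_ereal_sup => _ [x x1 <-]; rewrite lee_fin; exact: H.
Qed.

(** * Convexity of the programs, for an arbitrary set [A] so that (D) and (D') are covered
    together *)

Section ConvexPrograms.
Variables (R : realType) (m n N : nat) (V0 eps : R) (TC : 'I_m -> R -> R).
Variables (lo : 'rV[R]_m) (xhat : 'I_N -> 'rV[R]_m) (nrm : 'rV[R]_m -> R).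
Hypothesis V0_gt0 : 0 < V0.
Hypothesis TC_convex :
  forall i, convex_function (`[0, V0] : set R^o) (TC i).

Lemma convex_dro_feasible (A : set 'rV[R]_m) :
  convex_set (dro_feasible V0 TC lo xhat nrm A
    : set (convex_lmodType (decision R m N))).
Proof.
move=> [[[w1 l1] s1] z1] [[[w2 l2] s2] z2] t.
move=> /set_mem[s1A l1_ge0 z1l w1S] /set_mem[s2A l2_ge0 z2l w2S].
have [t0 t1] := conv_weight_bounds t; apply/mem_set.
(* Convex combinations of decisions are computed componentwise. *)
change (dro_feasible V0 TC lo xhat nrm A
  (t%:num *: w1 + (1 - t%:num) *: w2, t%:num * l1 + (1 - t%:num) * l2,
   t%:num *: s1 + (1 - t%:num) *: s2, t%:num *: z1 + (1 - t%:num) *: z2)).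
have row_conv j : row j (t%:num *: z1 + (1 - t%:num) *: z2) =
    t%:num *: row j z1 + (1 - t%:num) *: row j z2.
  by rewrite linearD !linearZ.
split=> [j||j|].
(* The bound on the infimum is checked at each [x] of [A] separately. *)
- apply: le_ereal_inf_tmp => _ [x Ax <-].
  have inf_le w s z : (s%:E <= ereal_inf [set log_term V0 TC w (row j z) (xhat j) x
        | x in A])%E -> (s%:E <= log_term V0 TC w (row j z) (xhat j) x)%E.
    by move=> /le_trans; apply; apply: ereal_inf_lbound; exists x.
  have cc := @net_wealth_concave _ _ _ _ V0_gt0 TC_convex t w1 w2
    (closure_safe_weights_simplex w1S) (closure_safe_weights_simplex w2S).
  rewrite row_conv 3!mxE /log_term (dotZDl _ _ (row j z1)).
  apply: le_lneD_conv (inf_le _ _ _ (s1A j)) (inf_le _ _ _ (s2A j)) _.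
  by rewrite dotZDl; lra.
- by rewrite addr_ge0// mulr_ge0// subr_ge0.
- rewrite row_conv; apply/dual_norm_leP => x x1; rewrite dotZDl.
  have := (dual_norm_leP _ _ _).1 (z1l j) _ x1.
  have := (dual_norm_leP _ _ _).1 (z2l j) _ x1.
  nra.
- apply: set_mem; apply: convex_closure (mem_set w1S) (mem_set w2S).
  exact: convex_safe_weights.
Qed.

(** The objective is linear in the decision variables, whence an equality. *)
Lemma dro_objective_conv (t : {i01 R})
    (d1 d2 : convex_lmodType (decision R m N)) :
  dro_objective n eps (conv t d1 d2) =
  t%:num * dro_objective n eps d1 + (1 - t%:num) * dro_objective n eps d2.
Proof.
case: d1 d2 => [[[w1 l1] s1] z1] [[[w2 l2] s2] z2].
change (dro_objective n eps
    (t%:num *: w1 + (1 - t%:num) *: w2, t%:num * l1 + (1 - t%:num) * l2,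
     t%:num *: s1 + (1 - t%:num) *: s2, t%:num *: z1 + (1 - t%:num) *: z2)
  = t%:num * dro_objective n eps (w1, l1, s1, z1) +
    (1 - t%:num) * dro_objective n eps (w2, l2, s2, z2)).
rewrite /dro_objective; under eq_bigr do rewrite 3!mxE.
by rewrite big_split/= -!mulr_sumr; ring.
Qed.

Lemma convex_dro_program (A : set 'rV[R]_m) :
  convex_program (dro_program n V0 eps TC lo xhat nrm A).
Proof.
split; first exact: convex_dro_feasible.
move=> t d1 d2 _ _.
change (- dro_objective n eps (conv t d1 d2) <=
  t%:num * - dro_objective n eps d1 + (1 - t%:num) * - dro_objective n eps d2).
by rewrite dro_objective_conv !mulrN -opprD.
Qed.

End ConvexPrograms.

(** Only the constraints on [s] involve the set of scenarios, and only through an infimum that is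
    the same over the box and over its extreme points. *)
Lemma dro_feasible_extreme_points (R : realType) (m N : nat) (V0 : R)
    (TC : 'I_m -> R -> R) (lo hi : 'rV[R]_m) (xhat : 'I_N -> 'rV[R]_m)
    (nrm : 'rV[R]_m -> R) :
  (forall i, lo 0 i <= hi 0 i) ->
  dro_feasible V0 TC lo xhat nrm (extreme_points (box lo hi)) =
  dro_feasible V0 TC lo xhat nrm (box lo hi).
Proof.
move=> lo_hi; apply/funext => -[[[w l] s] z].
have infE j := ereal_inf_extreme_points lo_hi
  (@log_term_lty _ _ V0 TC w (row j z) (xhat j))
  (@convex_log_term_superlevel _ _ V0 TC w (row j z) (xhat j)).
by apply/propext; split=> -[sinf l0 zl wS]; split=> // j;
  [rewrite -infE | rewrite infE]; exact: sinf.
Qed.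

Theorem corollary3p2 (R : realType) (m n N : nat) (V0 eps : R)
    (TC : 'I_m -> R -> R) (Xmin Xmax : 'rV[R]_m)
    (xhat : 'I_N -> 'rV[R]_m) (nrm : 'rV[R]_m -> R)
    (lo := compound n Xmin) (hi := compound n Xmax)
    (supp := box lo hi)
    (D := dro_program n V0 eps TC lo xhat nrm supp)
    (D' := dro_program n V0 eps TC lo xhat nrm (extreme_points supp)) :
  (0 < n)%N -> (0 < N)%N -> 0 < V0 -> 0 < eps ->
  (forall i, -1 < lo 0 i) ->
  (forall i, lo 0 i <= hi 0 i) ->
  (forall i, {within `[0, V0], continuous (TC i)}) ->
  (forall i, convex_function (`[0, V0] : set R^o) (TC i)) ->
  (forall w, simplex w -> 0 <= total_cost V0 TC w < V0) ->
  is_norm nrm ->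
  [/\ forall w z j, closure (safe_weights V0 TC lo) w ->
        attains_min supp (log_term V0 TC w z (xhat j)) /\
        attains_min (extreme_points supp) (log_term V0 TC w z (xhat j)),
      convex_program D,
      convex_program D'
    & equivalent_programs D D'].
Proof.
move=> _ _ V0_gt0 _ _ lo_hi _ TC_convex _ _.
(* With a common objective, equal feasible sets make the two programs equal as records, so that
   equivalence becomes reflexivity. *)
have DD' : D = D' by rewrite /D /D' /dro_program dro_feasible_extreme_points.
split=> [w z j _|||].
- by split; [apply: box_attains_min | apply: extreme_points_attains_min] => //;
    [exact: log_term_lty | exact: convex_log_term_superlevel
    |exact: log_term_lty | exact: convex_log_term_superlevel].
- exact: convex_dro_program.
- exact: convex_dro_program.
- by rewrite -DD'.
Qed.
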